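(* Let $\Omega\subset\mathbb{R}^n$ be a bounded Lipschitz domain and let $E_0\subset\mathcal{C}\Omega$ be a given set. There exists a set $E$ with $E\cap\mathcal{C}\Omega=E_0$ such that $$\inf_{F\cap\mathcal{C}\Omega=E_0}\mathcal{J}_\Omega(F)=\mathcal{J}_\Omega(E).$$
   Context: Fix $n\ge1$ and $0<s<1$. All sets are Lebesgue measurable; $\mathcal{C}A=\mathbb{R}^n\setminus A$. For $A,B\subset\mathbb{R}^n$, $L(A,B):=\int\int\frac{\chi_A(x)\chi_B(y)}{|x-y|^{n+s}}\,dx\,dy\in[0,\infty]$. For a bounded set $\Omega$ and $E\subset\mathbb{R}^n$, $\mathcal{J}_\Omega(E):=L(E\cap\Omega,\mathcal{C}E)+L(E\setminus\Omega,\mathcal{C}E\cap\Omega)$. *)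

(* Defs.v *)
From HB Require Import structures.
From mathcomp Require Import all_boot all_order all_algebra.
From mathcomp Require Import all_classical all_reals all_analysis.

Set Implicit Arguments.
Unset Strict Implicit.
Unset Printing Implicit Defensive.

Import Order.TTheory GRing.Theory Num.Theory.
Import numFieldNormedType.Exports.

Local Open Scope classical_set_scope.
Local Open Scope ring_scope.

(* The library's norm on 'rV[R]_n is the sup norm. *)
Definition enorm {R : realType} {n : nat} (x : 'rV[R]_n) : R :=
  Num.sqrt (\sum_(i < n) x ord0 i ^+ 2).

(** * Lebesgue measure on R^(n+1)

   The outer measure is the infimum of the total volume over countable covers
   by half-open boxes; the Lebesgue measurable sets are its Caratheodory
   measurable sets. The dimension is written n.+1 because in dimension 0 the
   empty product would give volume 1 to the boxes covering the empty set. *)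

Definition hbox {R : realType} {n : nat} (ab : 'rV[R]_n.+1 * 'rV[R]_n.+1) :
    set 'rV[R]_n.+1 :=
  [set x | forall i, ab.1 ord0 i < x ord0 i <= ab.2 ord0 i].

(* [ab.1] need not be below [ab.2]: in that case the hbox is empty and the
   volume is 0. *)
Definition box_volume {R : realType} {n : nat}
    (ab : 'rV[R]_n.+1 * 'rV[R]_n.+1) : R :=
  \prod_(i < n.+1) Num.max 0 (ab.2 ord0 i - ab.1 ord0 i).

Definition lebesgue_outer (R : realType) (n : nat) (X : set 'rV[R]_n.+1) :
    \bar R :=
  ereal_inf [set (\sum_(0 <= k <oo) (box_volume (c k))%:E)%E |
    c in [set c : ('rV[R]_n.+1 * 'rV[R]_n.+1)^nat |
           X `<=` \bigcup_k hbox (c k)]].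

Section lebesgue_outer_measure.
Local Open Scope ereal_scope.
Variables (R : realType) (n : nat).
Implicit Types X : set 'rV[R]_n.+1.

Let vol (ab : 'rV[R]_n.+1 * 'rV[R]_n.+1) : \bar R := (box_volume ab)%:E.

Let vol_ge0 ab : 0 <= vol ab.
Proof. by rewrite lee_fin; apply: prodr_ge0 => i _; rewrite le_max lexx. Qed.

Lemma lebesgue_outer_ge0 X : 0 <= lebesgue_outer X.
Proof.
by apply: le_ereal_inf_tmp => _ [c _ <-]; apply: nneseries_ge0 => k _ _; exact: vol_ge0.
Qed.

Lemma lebesgue_outer0 : lebesgue_outer (set0 : set 'rV[R]_n.+1) = 0.
Proof.
apply/eqP; rewrite eq_le; apply/andP; split; last exact: lebesgue_outer_ge0.
apply: ereal_inf_lbound; exists (fun=> (0, 0)%R) => //.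
apply: eseries0 => k _ _; congr EFin.
by apply/eqP/prodf_eq0; exists ord0 => //; rewrite /= mxE subrr maxxx.
Qed.

Lemma le_lebesgue_outer :
  {homo (@lebesgue_outer R n) : A B / A `<=` B >-> A <= B}.
Proof.
move=> A B AB; apply/ereal_inf_le_tmp => _ [c Bc <-].
by exists c => //; exact: subset_trans AB Bc.
Qed.

Lemma lebesgue_outer_sigma_subadditive :
  sigma_subadditive (@lebesgue_outer R n).
Proof.
move=> A; have [[i ioo]|] := pselect (exists i, lebesgue_outer (A i) = +oo).
  rewrite (eseries_pinfty _ _ ioo) ?leey// => k _.
  by rewrite -ltNye (lt_le_trans _ (lebesgue_outer_ge0 _)).
rewrite -forallNE => Aoo.
suff add2e (e : {posnum R}) : lebesgue_outer (\bigcup_k A k) <=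
    \sum_(i <oo) lebesgue_outer (A i) + e%:num%:E.
  by apply/lee_addgt0Pr => _/posnumP[].
rewrite (le_trans _ (epsilon_trick _ _ _))//; last first.
  by move=> k; exact: lebesgue_outer_ge0.
pose P k (c : ('rV[R]_n.+1 * 'rV[R]_n.+1)^nat) :=
  A k `<=` \bigcup_j hbox (c j) /\
  \sum_(j <oo) vol (c j) <=
    lebesgue_outer (A k) + (e%:num / (2 ^ k.+1)%:R)%:E.
have [G PG] : {G : nat -> ('rV[R]_n.+1 * 'rV[R]_n.+1)^nat & forall k, P k (G k)}.
  apply: (@choice _ _ P) => k; rewrite /P /lebesgue_outer.
  set S := (X in ereal_inf X); move infS : (ereal_inf S) => iS.
  case: iS infS => [r Sr|Soo|Soo].
  - have en1 : (0 < e%:num / (2 ^ k.+1)%:R)%R by [].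
    have /(lb_ereal_inf_adherent en1) : ereal_inf S \is a fin_num by rewrite Sr.
    move=> [x [c Ac cx] xS].
    by exists c; split => //; rewrite cx -Sr; exact/ltW.
  - by have := Aoo k; rewrite /lebesgue_outer Soo.
  - suff : lbound S 0 by move/le_ereal_inf_tmp; rewrite Soo.
    by move=> /= _ [c Ac <-]; apply: nneseries_ge0 => j _ _; exact: vol_ge0.
apply: (@le_trans _ _ (\esum_(i in setT) (vol \o uncurry G) i)).
  apply: ereal_inf_lbound => /=.
  have /card_esym/ppcard_eqP[f] := card_nat2.
  exists (uncurry G \o f).
    move=> t [i _ /(PG i).1 [j _ Gt]]; exists (f^-1%FUN (i, j)) => //=.
    by rewrite invK ?inE.
  rewrite -(esum_pred_image (vol \o uncurry G) _ xpredT) ?[fun=> _]set_true//.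
    by rewrite image_eq.
  by move=> k _; exact: vol_ge0.
rewrite (_ : esum _ _ = \sum_(i <oo) \sum_(j <oo) vol (G i j)); last first.
  pose J : nat -> set (nat * nat) := fun i => [set (i, j) | j in setT].
  rewrite (_ : setT = \bigcup_k J k); last first.
    by rewrite predeqE => -[a b]; split => // _; exists a => //; exists b.
  rewrite esum_bigcupT /=; last 2 first.
    - apply/trivIsetP => i j _ _ ij.
      rewrite predeqE => -[m k] /=; split => //= -[] [_] _ [<-{m} _].
      by move=> [m' _] [] /esym/eqP; rewrite (negbTE ij).
    - by move=> /= [m k]; exact: vol_ge0.
  rewrite -(image_id [set: nat]) -fun_true esum_pred_image//; last first.
    by move=> k _; apply: esum_ge0 => *; exact: vol_ge0.
  apply: eq_eseriesr => /= j _.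
  rewrite -(esum_pred_image (vol \o uncurry G) (pair j) predT)//=; last first.
    by move=> ? ? _ _; exact: (@can_inj _ _ _ snd).
  by congr esum; rewrite predeqE => -[a b]; split; move=> [i _ <-]; exists i.
apply: lee_nneseries => [k _ _|k _]; last exact: (PG k).2.
by apply: nneseries_ge0 => j _ _; exact: vol_ge0.
Qed.

HB.instance Definition _ := isOuterMeasure.Build R _ (@lebesgue_outer R n)
  lebesgue_outer0 lebesgue_outer_ge0 le_lebesgue_outer
  lebesgue_outer_sigma_subadditive.

Definition lebesgue_rV :
    set (caratheodory_type (@lebesgue_outer R n)) -> \bar R :=
  @lebesgue_outer R n.

Let lebesgue_rV0 : lebesgue_rV set0 = 0.
Proof. exact: lebesgue_outer0. Qed.

Let lebesgue_rV_ge0 A : 0 <= lebesgue_rV A.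
Proof. exact: lebesgue_outer_ge0. Qed.

Let lebesgue_rV_sigma_additive : semi_sigma_additive lebesgue_rV.
Proof. exact: caratheodory_measure_sigma_additive. Qed.

HB.instance Definition _ := isMeasure.Build _ _ _ lebesgue_rV
  lebesgue_rV0 lebesgue_rV_ge0 lebesgue_rV_sigma_additive.

Definition lebesgue_measurable (A : set 'rV[R]_n.+1) : Prop :=
  (@lebesgue_outer R n).-cara.-measurable A.

End lebesgue_outer_measure.

(** * The functional *)

(* On the diagonal, which is a null set, this is 0 since 0^-1 = 0. *)
Definition fractional_kernel {R : realType} {n : nat} (s : R) (x y : 'rV[R]_n.+1) : R :=
  (enorm (x - y) `^ (n.+1%:R + s))^-1.

Definition interaction {R : realType} {n : nat} (s : R)
    (A B : set 'rV[R]_n.+1) : \bar R :=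
  (\int[@lebesgue_rV R n]_y \int[@lebesgue_rV R n]_x
     (\1_A x * \1_B y * fractional_kernel s x y)%:E)%E.

Definition Jfun {R : realType} {n : nat} (s : R) (Omega E : set 'rV[R]_n.+1) :
    \bar R :=
  (interaction s (E `&` Omega) (~` E)
   + interaction s (E `\` Omega) (~` E `&` Omega))%E.

(** * Lipschitz domains *)

Definition boundary {T : topologicalType} (A : set T) : set T :=
  closure A `\` interior A.

(* Up to an isometry z = (x - p) Q sending p to the origin, Omega is the
   subgraph of a Lipschitz function of the first n coordinates in a cylinder
   around p. Whether g is Lipschitz does not depend on the norm of R^n. *)
Definition lipschitz_graph_at {R : realType} {n : nat}
    (Omega : set 'rV[R]_n.+1) (p : 'rV[R]_n.+1) : Prop :=
  exists (Q : 'M[R]_n.+1) (r h : R) (g : 'rV[R]_n -> R),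
    [/\ Q *m Q^T = 1%:M, 0 < r, 0 < h, lipschitz g &
      forall x : 'rV[R]_n.+1,
        let z := (x - p) *m Q in
        let z' := col' ord_max z in
        let zn := z ord0 ord_max in
        enorm z' < r -> `|zn| < h ->
        (Omega x <-> zn < g z') /\ (boundary Omega x <-> zn = g z')].

Definition lipschitz_domain {R : realType} {n : nat}
    (Omega : set 'rV[R]_n.+1) : Prop :=
  open Omega /\ forall p, boundary Omega p -> lipschitz_graph_at Omega p.

(* Main.v *)
(** The functional is submodular,
      J(A `|` B) + J(A `&` B) <= J(A) + J(B),
    because its integrand is, pair of points by pair of points; and by Fatou it
    is lower semicontinuous along pointwise convergent sequences of sets. This
    replaces compactness: if the F_k are admissible with J(F_k) <= inf J + 2^-k,
    then each intersection costs at least inf J, so submodularity gives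
    J(F_k `|` ... `|` F_(k+j)) <= inf J + 2 * 2^-k. Letting j, then k, tend to
    infinity, the limit superior of the F_k is a minimizer. *)

Require Import Defs.
From HB Require Import structures.
From mathcomp Require Import all_boot all_order all_algebra.
From mathcomp Require Import all_classical all_reals all_analysis.
From mathcomp Require Import measurable_realfun lra.
Import Order.TTheory GRing.Theory Num.Theory.
Import numFieldNormedType.Exports.
Local Open Scope classical_set_scope.
Local Open Scope ring_scope.

(** * Minimization of a submodular, lower semicontinuous set function *)

Section submodular_minimization.
Local Open Scope ereal_scope.
Context {T : Type} {R : realType}.
Variables (J : set T -> \bar R) (D : set (set T)).
Hypothesis J_ge0 : forall A, D A -> 0 <= J A.
Hypothesis DU : forall A B, D A -> D B -> D (A `|` B).
Hypothesis DI : forall A B, D A -> D B -> D (A `&` B).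
Hypothesis D_bigcup : forall F : (set T)^nat,
  (forall k, D (F k)) -> D (\bigcup_k F k).
Hypothesis D_bigcap : forall F : (set T)^nat,
  (forall k, D (F k)) -> D (\bigcap_k F k).
Hypothesis J_submodular : forall A B, D A -> D B ->
  J (A `|` B) + J (A `&` B) <= J A + J B.
(** The bound [C] is uniform in [k]: a sequence known to obey it only from some index on is shifted
    before this is applied. *)
Hypothesis J_lsc : forall (F : (set T)^nat) A (C : \bar R),
  (forall k, D (F k)) -> D A ->
  (forall x, \forall k \near \oo, F k x <-> A x) ->
  (forall k, J (F k) <= C) -> J A <= C.

Let m := ereal_inf (J @` D).

Let m_le A : D A -> m <= J A.
Proof. by move=> DA; apply: ereal_inf_lbound; exists A. Qed.

Let bigcup_ltS (F : (set T)^nat) j :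
  \bigcup_(i < j.+1) F i = \bigcup_(i < j) F i `|` F j.
Proof. by rewrite !bigcup_mkord big_ord_recr. Qed.

Let bigcup_lt1 (F : (set T)^nat) : \bigcup_(i < 1) F i = F 0%N.
Proof. by rewrite bigcup_ltS bigcup_mkord big_ord0 set0U. Qed.

Let D_bigcup_lt (F : (set T)^nat) j : (forall i, D (F i)) ->
  D (\bigcup_(i < j.+1) F i).
Proof.
move=> DF; elim: j => [|j IHj]; first by rewrite bigcup_lt1.
by rewrite bigcup_ltS; exact: DU.
Qed.

(* The defects add up along the union because each intersection that is
   discarded still costs at least [m]. *)
Let bigcup_lt_bound (F : (set T)^nat) (c : R) j : m \is a fin_num ->
  (forall i, D (F i)) ->
  (forall i, J (F i) <= m + (c * 2 ^- i)%:E) ->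
  J (\bigcup_(i < j.+1) F i) <= m + (c * (2 - 2 ^- j))%:E.
Proof.
move=> mfin DF JF; elim: j => [|j IHj].
  rewrite bigcup_lt1; apply: (le_trans (JF 0%N)); rewrite leeD2l// lee_fin.
  by rewrite expr0; lra.
rewrite bigcup_ltS.
have DV := D_bigcup_lt F j DF.
have JIm := m_le _ (DI _ _ DV (DF j.+1)).
have := J_submodular _ _ DV (DF j.+1).
move=> /(le_trans (leeD (lexx _) JIm)) /le_trans /(_ (leeD IHj (JF j.+1))).
(* As [m] is finite, it can be added to both sides of the goal. The constants then match because 2 -
   2^-j + 2^-(j+1) = 2 - 2^-(j+1). *)
rewrite -(@leeD2rE _ m (J _))// => /le_trans; apply.
move: mfin; case: (m) => // r _; rewrite -!EFinD lee_fin exprS invfM.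
lra.
Qed.

Lemma submodular_minimizer : D !=set0 ->
  exists2 E, D E & ereal_inf (J @` D) = J E.
Proof.
(* If the infimum is infinite, every admissible set attains it. *)
move=> [E0 DE0]; have [moo|moo] := eqVneq m +oo.
  exists E0 => //; apply/eqP; rewrite eq_le m_le//=.
  by rewrite -/m moo leey.
have mfin : m \is a fin_num.
  rewrite ge0_fin_numE ?ltey//.
  by apply: le_ereal_inf_tmp => _ [A DA <-]; exact: J_ge0.
have /choice[F DF] k : exists A, D A /\ J A <= m + ((2 ^- k)%R)%:E.
  have [|_ [A DA <-] /ltW JA] := @lb_ereal_inf_adherent _ (J @` D) (2 ^- k) _ mfin.
    by rewrite invr_gt0 exprn_gt0.
  by exists A.
have DFk k : D (F k) by have [] := DF k.
pose G k := \bigcup_i F (k + i)%N.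
have DG k : D (G k) by exact: D_bigcup.
have JG k : J (G k) <= m + ((2 * 2 ^- k)%R)%:E.
  (* The partial unions increase to [G k]. The shifted sequence has defects 2^-(k+i) = 2^-k 2^-i, so
     [bigcup_lt_bound] applies with [c] equal to 2^-k. *)
  apply: (J_lsc (fun j => \bigcup_(i < j.+1) F (k + i)%N)) => // [j|x|j].
  - exact: (D_bigcup_lt (fun i => F (k + i)%N)).
  - have [[i _ Fx]|nGx] := pselect (G k x).
      exists i => // j /= ij; split => _; first by exists i.
      by exists i.
    by exists 0%N => // j _; split => // -[i _ Fx]; exfalso; apply: nGx; exists i.
  - apply: (le_trans (@bigcup_lt_bound (fun i => F (k + i)%N) (2 ^- k) j mfin _ _)) => //.
      by move=> i; have [_] := DF (k + i)%N; rewrite exprD invfM.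
    rewrite leeD2l// lee_fin mulrC ler_pM2r ?invr_gt0 ?exprn_gt0//.
    by rewrite gerBl invr_ge0 exprn_ge0.
have GS k j : (k <= j)%N -> G j `<=` G k.
  move=> kj x [i _ Fx]; exists (j - k + i)%N => //.
  by rewrite addnA subnKC.
pose E := \bigcap_k G k.
have DE : D E by exact: D_bigcap.
exists E => //; apply/eqP; rewrite eq_le m_le//= -/m.
have JE k : J E <= m + ((2 * 2 ^- k)%R)%:E.
  (* The sets [G (k + j)] decrease to [E], and all obey the bound of [G k] because 2^-(k+j) <=
     2^-k. *)
  apply: (J_lsc (fun j => G (k + j)%N)) => // [x|j].
    have [Ex|/existsNP[i nGx]] := pselect (E x).
      by exists 0%N => // j _; split => // _; exact: Ex.
    exists i => // j /= ij; split => [Gx|/(_ (k + j)%N)]; last exact.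
    by exfalso; apply: nGx => _; apply: GS Gx; rewrite (leq_trans ij)// leq_addl.
  apply: (le_trans (JG _)); rewrite leeD2l// lee_fin ler_pM2l//.
  by rewrite lef_pV2 ?posrE ?exprn_gt0// ler_weXn2l ?ler1n// leq_addr.
apply/lee_addgt0Pr => e e0.
have [k _ /(_ _ (leqnn k)) ke] := near_infty_natSinv_expn_lt (PosNum (divr_gt0 e0 (ltr0Sn R 1))).
apply: (le_trans (JE k)); rewrite leeD2l// lee_fin.
move: ke => /=; rewrite div1r; lra.
Qed.

End submodular_minimization.

(** * Tonelli's theorem for nested integrals *)

Section iterated_integral.
Local Open Scope ereal_scope.
Context {d : measure_display} {T : measurableType d} {R : realType}.
Variable mu : {sigma_finite_measure set T -> \bar R}.
Implicit Types f g : T -> T -> R.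

Lemma ge0_iterated_integralE f :
  measurable_fun [set: T * T] (fun z => f z.1 z.2) ->
  (forall x y, 0 <= f x y)%R ->
  \int[mu]_y \int[mu]_x (f x y)%:E = \int[mu \x mu]_z (f z.1 z.2)%:E.
Proof.
move=> mf f0; rewrite (fubini_tonelli2 (fun z => (f z.1 z.2)%:E))//.
  exact/measurable_EFinP.
by move=> z; rewrite lee_fin.
Qed.

(** On the product measure this is additivity of a single integral, so the measurability of the
    inner integrals never has to be discussed. *)
Lemma ge0_iterated_integralD f g :
  measurable_fun [set: T * T] (fun z => f z.1 z.2) ->
  measurable_fun [set: T * T] (fun z => g z.1 z.2) ->
  (forall x y, 0 <= f x y)%R -> (forall x y, 0 <= g x y)%R ->
  \int[mu]_y \int[mu]_x (f x y + g x y)%:E =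
  \int[mu]_y \int[mu]_x (f x y)%:E + \int[mu]_y \int[mu]_x (g x y)%:E.
Proof.
move=> mf mg f0 g0; rewrite !ge0_iterated_integralE//; first last.
- by move=> x y; exact: addr_ge0.
- exact: measurable_funD.
rewrite -ge0_integralD//.
- by move=> z _; rewrite lee_fin.
- exact/measurable_EFinP.
- by move=> z _; rewrite lee_fin.
- exact/measurable_EFinP.
Qed.

End iterated_integral.

(** * Nonlocal functionals with a nonnegative kernel *)

Section nonlocal_functional.
Local Open Scope ereal_scope.
Context {d : measure_display} {T : measurableType d} {R : realType}.
Variable mu : {sigma_finite_measure set T -> \bar R}.
Variable K : T -> T -> R.
Hypothesis mK : measurable_fun [set: T * T] (fun z => K z.1 z.2).
Hypothesis K_ge0 : forall x y, (0 <= K x y)%R.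

Let nonlocal_integrand (A : set T) (z : T * T) : R :=
  (\1_A z.1 * \1_(~` A) z.2 * K z.1 z.2)%R.

(** Written as a nested integral to match [interaction]; [nonlocalE] passes to the product
    measure. *)
Definition nonlocal (A : set T) : \bar R :=
  \int[mu]_y \int[mu]_x (\1_A x * \1_(~` A) y * K x y)%:E.

Let nonlocal_integrand_ge0 A z : (0 <= nonlocal_integrand A z)%R.
Proof. by rewrite /nonlocal_integrand !mulr_ge0. Qed.

Let measurable_nonlocal_integrand A : measurable A ->
  measurable_fun setT (EFin \o nonlocal_integrand A).
Proof.
move=> mA; apply/measurable_EFinP; apply: measurable_funM => //.
apply: measurable_funM.
- exact: measurableT_comp (measurable_indic _) measurable_fst.
- by apply: measurableT_comp (measurable_indic _) measurable_snd; exact: measurableC.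
Qed.

Let nonlocalE A : measurable A ->
  nonlocal A = \int[mu \x mu]_z (nonlocal_integrand A z)%:E.
Proof.
move=> mA; apply: (ge0_iterated_integralE mu (fun x y => nonlocal_integrand A (x, y))).
  by have /measurable_EFinP := measurable_nonlocal_integrand A mA.
by move=> x y; exact: nonlocal_integrand_ge0.
Qed.

Lemma nonlocal_ge0 A : 0 <= nonlocal A.
Proof.
apply: integral_ge0 => y _; apply: integral_ge0 => x _.
by rewrite lee_fin (nonlocal_integrand_ge0 A (x, y)).
Qed.

Lemma nonlocal_submodular A B : measurable A -> measurable B ->
  nonlocal (A `|` B) + nonlocal (A `&` B) <= nonlocal A + nonlocal B.
Proof.
move=> mA mB.
have mI C : measurable C -> measurable_fun setT (EFin \o nonlocal_integrand C).
  exact: measurable_nonlocal_integrand.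
have I0 C z : [set: T * T] z -> 0 <= (EFin \o nonlocal_integrand C) z.
  by move=> _; rewrite lee_fin nonlocal_integrand_ge0.
have mU := measurableU _ _ mA mB; have mAB := measurableI _ _ mA mB.
rewrite !nonlocalE// -!ge0_integralD//; try by [exact: mI|exact: I0].
apply: ge0_le_integral => //.
- by move=> z _; apply: adde_ge0; exact: I0.
- by apply: emeasurable_funD; exact: mI.
- by apply: emeasurable_funD; exact: mI.
(* With the kernel factored out, sixteen cases of membership remain. The two sides differ only when
   one point lies in A minus B and the other in B minus A: there the left side is 0 and the right
   side is 1. *)
move=> z _; rewrite -!EFinD lee_fin /nonlocal_integrand -!mulrDl.
apply: ler_wpM2r => //; rewrite !indicE !in_setC !in_setU !in_setI.
by do 4!case: (_ \in _); rewrite /=; lra.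
Qed.

Lemma nonlocal_lsc (F : (set T)^nat) (A : set T) (C : \bar R) :
  (forall k, measurable (F k)) -> measurable A ->
  (forall x, \forall k \near \oo, F k x <-> A x) ->
  (forall k, nonlocal (F k) <= C) -> nonlocal A <= C.
Proof.
move=> mF mA FA FC; rewrite nonlocalE//.
(* At each pair of points the integrands of the [F k] are eventually constant, so their lower limit
   is the integrand of [A], as Fatou's lemma requires. *)
have -> : \int[mu \x mu]_z (nonlocal_integrand A z)%:E =
    \int[mu \x mu]_z limn_einf (fun k => (nonlocal_integrand (F k) z)%:E).
  apply: eq_integral => z _; apply/esym.
  have [->//] : ((limn_einf (fun k => (nonlocal_integrand (F k) z)%:E) =
      (nonlocal_integrand A z)%:E) *
    (limn_esup (fun k => (nonlocal_integrand (F k) z)%:E) =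
      (nonlocal_integrand A z)%:E))%type.
  apply: cvg_limn_einf_sup; apply: cvg_near_cst.
  near=> k; congr (_%:E); rewrite /nonlocal_integrand !indicE !in_setC.
  have mem x : (F k x <-> A x) -> (x \in F k) = (x \in A).
    by move=> FAx; apply/idP/idP; rewrite !inE => /FAx.
  by rewrite !mem//; near: k; exact: FA.
apply: (le_trans (fatou _ _ _ _)) => //.
- by move=> k; exact: measurable_nonlocal_integrand.
- by move=> k z _; rewrite lee_fin nonlocal_integrand_ge0.
(* The lower limit is the limit of the infima over tails, and the infimum over the tail from [k] is
   at most the [k]-th value, hence at most [C]. *)
rewrite limn_einf_lim; apply: lime_le; first exact: is_cvg_einfs.
apply: nearW => k; apply: le_trans (FC k).
by rewrite nonlocalE//; apply: ereal_inf_lbound; exists k => //=.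
Unshelve. all: by end_near.
Qed.

Lemma nonlocal_minimizer (D : set (set T)) :
  D `<=` measurable ->
  (forall A B, D A -> D B -> D (A `|` B)) ->
  (forall A B, D A -> D B -> D (A `&` B)) ->
  (forall F : (set T)^nat, (forall k, D (F k)) -> D (\bigcup_k F k)) ->
  (forall F : (set T)^nat, (forall k, D (F k)) -> D (\bigcap_k F k)) ->
  D !=set0 ->
  exists2 E, D E & ereal_inf (nonlocal @` D) = nonlocal E.
Proof.
move=> Dm DU DI Dcup Dcap; apply: (@submodular_minimizer T R nonlocal D).
- by move=> A _; exact: nonlocal_ge0.
- exact: DU.
- exact: DI.
- exact: Dcup.
- exact: Dcap.
- by move=> A B DA DB; apply: nonlocal_submodular; exact: Dm.
- by move=> F A C DF DA; apply: nonlocal_lsc => [k|]; exact: Dm.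
Qed.

End nonlocal_functional.

(** * Boxes, open sets and sigma-finiteness for Lebesgue measure *)

Section lebesgue_rV.
Variables (R : realType) (n : nat).
Notation T := (caratheodory_type (@lebesgue_outer R n)).
Implicit Types (ab : 'rV[R]_n.+1 * 'rV[R]_n.+1) (i : 'I_n.+1).

Lemma box_volume_ge0 ab : 0 <= box_volume ab.
Proof. by apply: prodr_ge0 => i _; rewrite le_max lexx. Qed.

(** The cut is along the hyperplane x_i = t, for arbitrary [t]: if it misses the box, one half has
    its endpoints out of order, so it is empty and has volume 0. *)
Definition lower_half ab i (t : R) : 'rV[R]_n.+1 * 'rV[R]_n.+1 :=
  (ab.1, \row_j if j == i then Num.min (ab.2 ord0 j) t else ab.2 ord0 j).

Definition upper_half ab i (t : R) : 'rV[R]_n.+1 * 'rV[R]_n.+1 :=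
  (\row_j if j == i then Num.max (ab.1 ord0 j) t else ab.1 ord0 j, ab.2).

(** Only the factor of index [i] changes, and max(0, b - a) = max(0, min(b, t) - a) + max(0, b -
    max(a, t)). *)
Lemma box_volume_split ab i (t : R) :
  box_volume ab = box_volume (lower_half ab i t) + box_volume (upper_half ab i t).
Proof.
rewrite /box_volume (bigD1 i)//= [in X in _ = X + _](bigD1 i)//=.
rewrite [in X in _ = _ + X](bigD1 i)//= !mxE eqxx.
under [in X in _ = _ * X + _]eq_bigr => j /negbTE ji do rewrite !mxE ji.
under [in X in _ = _ + _ * X]eq_bigr => j /negbTE ji do rewrite !mxE ji.
rewrite -mulrDl; congr (_ * _).
move: (ab.1 ord0 i) (ab.2 ord0 i) => a b.
case: (leP b t) => ?; case: (leP a t) => ?; rewrite /Num.max;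
  repeat (case: ifP => [|/negbT]; rewrite -?leNgt => ?); lra.
Qed.

Lemma hbox_lower_half ab i (t : R) :
  hbox ab `&` [set x | x ord0 i <= t] `<=` hbox (lower_half ab i t).
Proof.
move=> x [abx xt] j; have /andP[ax xb] := abx j.
by rewrite !mxE ax/=; case: eqP => // ->; rewrite le_min xt andbT; case/andP: (abx i).
Qed.

Lemma hbox_upper_half ab i (t : R) :
  hbox ab `&` [set x | t < x ord0 i] `<=` hbox (upper_half ab i t).
Proof.
move=> x [abx tx] j; have /andP[ax xb] := abx j.
by rewrite !mxE xb andbT; case: eqP => // ->; rewrite gt_max tx andbT; case/andP: (abx i).
Qed.

(** Caratheodory's criterion: cutting every box of a cover of [X] along the hyperplane yields covers
    of the two parts of [X], with the same total volume. *)
Lemma measurable_halfspace i (t : R) :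
  lebesgue_measurable [set x : 'rV[R]_n.+1 | x ord0 i <= t].
Proof.
apply: le_caratheodory_measurable => X.
apply: le_ereal_inf_tmp => _ [c Xc <-].
have sumE : (\sum_(0 <= k <oo) (box_volume (c k))%:E =
    \sum_(0 <= k <oo) (box_volume (lower_half (c k) i t))%:E +
    \sum_(0 <= k <oo) (box_volume (upper_half (c k) i t))%:E)%E.
  rewrite -nneseriesD; try by move=> k _ _; rewrite lee_fin box_volume_ge0.
  by apply: eq_eseriesr => k _; rewrite -EFinD -box_volume_split.
rewrite sumE; apply: leeD; apply: ereal_inf_lbound.
- exists (fun k => lower_half (c k) i t) => // x [/Xc[k _ ckx] xt].
  by exists k => //; apply: hbox_lower_half.
- exists (fun k => upper_half (c k) i t) => // x [/Xc[k _ ckx] /negP].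
  rewrite -ltNge => tx.
  by exists k => //; apply: hbox_upper_half.
Qed.

Lemma measurable_coord i :
  measurable_fun [set: T] (fun x : T => (x : 'rV[R]_n.+1) ord0 i).
Proof.
apply: (measurability (@RGenOInfty.G R)).
  exact: RGenOInfty.measurableE.
move=> /= _ [_ [t ->] <-]; rewrite setTI.
rewrite (_ : _ @^-1` _ = ~` [set x : T | (x : 'rV[R]_n.+1) ord0 i <= t]).
  exact/measurableC/measurable_halfspace.
by apply/seteqP; split=> x /=; rewrite in_itv/= andbT real_ltNge ?num_real// => /negP.
Qed.

Lemma measurable_coord_box (D : 'I_n.+1 -> set R) :
  (forall i, measurable (D i)) ->
  lebesgue_measurable [set x : 'rV[R]_n.+1 | forall i, D i (x ord0 i)].
Proof.
move=> mD; rewrite /lebesgue_measurable.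
rewrite (_ : [set _ | _] = \bigcap_(i in [set: 'I_n.+1])
    ((fun x : T => (x : 'rV[R]_n.+1) ord0 i) @^-1` D i)); last first.
  by apply/seteqP; split=> x /= Dx i; [move=> _|]; exact: Dx.
apply: fin_bigcap_measurable => // i _.
by rewrite -[X in measurable X]setTI; exact: measurable_coord.
Qed.

Lemma measurable_hbox ab : lebesgue_measurable (hbox ab).
Proof.
apply: (@measurable_coord_box
  (fun i => [set` `]ab.1 ord0 i, ab.2 ord0 i]])) => i.
exact: measurable_itv.
Qed.

Lemma lebesgue_outer_hbox ab : (lebesgue_outer (hbox ab) <= (box_volume ab)%:E)%E.
Proof.
apply: ereal_inf_lbound => /=.
(* The cover is the box itself, followed by degenerate boxes of volume 0. *)
exists (fun k => if k == 0%N then ab else (0, 0)).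
  by move=> x abx; exists 0%N.
rewrite (nneseries_split _ 1)/=; last by move=> k _; rewrite lee_fin box_volume_ge0.
rewrite big_mkord big_ord_recl big_ord0 adde0 eseries0 ?adde0// => -[//|k] _ _.
congr (_%:E); apply/eqP/prodf_eq0; exists ord0 => //.
by rewrite /= !mxE subrr maxxx.
Qed.

(** The product measure and Tonelli's theorem rest on this; the exhausting sets are growing
    cubes. *)
Lemma lebesgue_rV_sigma_finite : sigma_finite [set: T] (@lebesgue_rV R n).
Proof.
exists (fun k => hbox (const_mx (- k%:R), const_mx k%:R)).
  apply/esym; rewrite -subTset => x _.
  (* The sum of the bounds on the coordinates dominates each of them. *)
  exists (\sum_(i < n.+1) Num.bound `|x ord0 i|)%N => // i; rewrite !mxE.
  have := archi_boundP (normr_ge0 (x ord0 i)).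
  have : (Num.bound `|x ord0 i|)%:R <=
      (\sum_(i < n.+1) Num.bound `|x ord0 i|)%N%:R :> R.
    by rewrite ler_nat (bigD1 i)//= leq_addr.
  move=> bx; rewrite ltr_norml => xb; lra.
move=> k; split; first exact: measurable_hbox.
by apply: le_lt_trans (lebesgue_outer_hbox _) _; rewrite ltry.
Qed.

HB.instance Definition _ :=
  Measure_isSigmaFinite.Build _ _ _ (@lebesgue_rV R n) lebesgue_rV_sigma_finite.

(** [U] is the union of the cubes inside it with rational centre and radius 1/(k+1). There are
    countably many, and each is a product of intervals. *)
Lemma open_lebesgue_measurable (U : set 'rV[R]_n.+1) :
  open U -> lebesgue_measurable U.
Proof.
move=> oU.
pose B (q : 'rV[rat]_n.+1 * nat) : set 'rV[R]_n.+1 :=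
  [set x | forall i, ball (ratr (q.1 ord0 i) : R) q.2.+1%:R^-1 (x ord0 i)].
have -> : U = \bigcup_(q in [set q | B q `<=` U]) B q.
  apply/seteqP; split=> [x Ux|x [q +]]; last exact.
  have /nbhs_ballP[e /= e0 eU] : nbhs x U by exact: open_nbhs_nbhs.
  (* The radius is taken below [e] / 2 because points of the cube are compared with [x] through the
     centre. *)
  have [k _ /(_ _ (leqnn k))/= ke] :=
    near_infty_natSinv_lt (PosNum (divr_gt0 e0 (ltr0Sn R 1))).
  have /choice[q xq] (i : 'I_n.+1) :
      exists q : rat, ball (ratr q : R) k.+1%:R^-1 (x ord0 i).
    have k0 : (0 : R) < k.+1%:R^-1 by rewrite invr_gt0 ltr0n.
    have [|q] := @rat_in_itvoo R (x ord0 i - k.+1%:R^-1) (x ord0 i + k.+1%:R^-1).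
      by rewrite ltrD2l gtrN.
    by rewrite in_itv/= => qx; exists q; rewrite /ball/= ltr_distl.
  exists (\row_i q i, k) => [y By|i] /=; last by rewrite mxE; exact: xq.
  apply: eU; split => // i j; rewrite ord1.
  have := By j; rewrite /= mxE => qy.
  apply: le_ball (ball_triangle (ball_sym (xq j)) qy).
  by rewrite (splitr e) lerD// ltW.
rewrite bigcup_mkcond; apply: countable_bigcupT_measurable => // q.
case: ifPn => _; last exact: measurable0.
have mball i : measurable (ball (ratr (q.1 ord0 i) : R) q.2.+1%:R^-1).
  exact: measurable_ball.
exact: measurable_coord_box mball.
Qed.

(** * The fractional kernel, and [Jfun] as a nonlocal functional *)

Lemma measurable_fractional_kernel (s : R) :
  measurable_fun [set: T * T] (fun z : T * T => fractional_kernel s z.1 z.2).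
Proof.
(* Square root and inverse are absorbed into the exponent, leaving a real power of a polynomial in
   the coordinates. The identity also holds on the diagonal. *)
have -> : (fun z : T * T => fractional_kernel s z.1 z.2) =
    (fun z : T * T => (\sum_(i < n.+1)
      ((z.1 : 'rV[R]_n.+1) ord0 i - (z.2 : 'rV[R]_n.+1) ord0 i) ^+ 2)
      `^ (2^-1 * - (n.+1%:R + s))).
  apply/funext => z; rewrite /fractional_kernel powRrM powRN.
  rewrite powR12_sqrt; last by apply: sumr_ge0 => i _; exact: sqr_ge0.
  congr ((Num.sqrt _ `^ _)^-1); apply: eq_bigr => i _.
  by rewrite !mxE.
apply: (measurableT_comp (measurable_powR _)).
apply: measurable_sum => i; apply: measurable_funX; apply: measurable_funB.
- exact: measurableT_comp (measurable_coord i) measurable_fst.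
- exact: measurableT_comp (measurable_coord i) measurable_snd.
Qed.

Lemma fractional_kernel_ge0 (s : R) (x y : 'rV[R]_n.+1) :
  0 <= fractional_kernel s x y.
Proof. by rewrite invr_ge0 powR_ge0. Qed.

(* [x] ranges over F and [y] over its complement; only the pairs lying both
   outside Omega are left out of [Jfun]. *)
Definition Jkernel (s : R) (Omega : set T) (x y : T) : R :=
  (\1_Omega x + \1_(~` Omega) x * \1_Omega y) * fractional_kernel s x y.

Lemma measurable_indic_prod (A B : set T) : measurable A -> measurable B ->
  measurable_fun [set: T * T] (fun z => \1_A z.1 * \1_B z.2 : R).
Proof.
move=> mA mB; apply: measurable_funM.
- exact: measurableT_comp (measurable_indic mA) measurable_fst.
- exact: measurableT_comp (measurable_indic mB) measurable_snd.
Qed.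

Lemma measurable_Jkernel (s : R) (Omega : set T) : measurable Omega ->
  measurable_fun [set: T * T] (fun z => Jkernel s Omega z.1 z.2).
Proof.
move=> mO; apply: measurable_funM; last exact: measurable_fractional_kernel.
apply: measurable_funD.
  exact: measurableT_comp (measurable_indic mO) measurable_fst.
by apply: measurable_indic_prod => //; exact: measurableC.
Qed.

Lemma Jkernel_ge0 (s : R) (Omega : set T) x y : 0 <= Jkernel s Omega x y.
Proof. by rewrite mulr_ge0 ?fractional_kernel_ge0// addr_ge0// mulr_ge0. Qed.

(** Both interactions contain the indicator of [F] at [x] and of its complement at [y]; the
    remaining factors add up to [Jkernel]. *)
Lemma JfunE (s : R) (Omega F : set T) : measurable Omega -> measurable F ->
  Jfun s Omega F = nonlocal (@lebesgue_rV R n) (Jkernel s Omega) F.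
Proof.
move=> mO mF; have mCF := measurableC mF.
have mpair (A B : set T) : measurable A -> measurable B ->
    measurable_fun [set: T * T]
      (fun z => \1_A z.1 * \1_B z.2 * fractional_kernel s z.1 z.2).
  move=> mA mB; apply: measurable_funM; last exact: measurable_fractional_kernel.
  exact: measurable_indic_prod.
have pair_ge0 (A B : set T) x y : 0 <= \1_A x * \1_B y * fractional_kernel s x y.
  by rewrite !mulr_ge0// fractional_kernel_ge0.
have := ge0_iterated_integralD (@lebesgue_rV R n)
  (fun x y => \1_(F `&` Omega) x * \1_(~` F) y * fractional_kernel s x y)
  (fun x y => \1_(F `\` Omega) x * \1_(~` F `&` Omega) y * fractional_kernel s x y)
  (mpair _ _ (measurableI _ _ mF mO) mCF)
  (mpair _ _ (measurableD mF mO) (measurableI _ _ mCF mO))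
  (pair_ge0 _ _) (pair_ge0 _ _).
move=> /esym; rewrite /Jfun /interaction => ->.
apply: eq_integral => y _; apply: eq_integral => x _; congr (_%:E).
rewrite /Jkernel mulrA -mulrDl; congr (_ * _).
rewrite !indicE !in_setD !in_setI !in_setC.
by do 4!case: (_ \in _); rewrite /=; lra.
Qed.

End lebesgue_rV.

(** * Minimization with prescribed exterior data *)

Theorem theorem3p2 (R : realType) (n : nat) (s : R)
    (Omega E0 : set 'rV[R]_n.+1) :
  0 < s < 1 ->
  bounded_set Omega ->
  lipschitz_domain Omega ->
  lebesgue_measurable E0 ->
  E0 `<=` ~` Omega ->
  exists E : set 'rV[R]_n.+1,
    [/\ lebesgue_measurable E,
        E `&` ~` Omega = E0 &
        ereal_inf [set Jfun s Omega F | F in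
          [set F | lebesgue_measurable F /\ F `&` ~` Omega = E0]]
        = Jfun s Omega E].
Proof.
move=> _ _ [/open_lebesgue_measurable mO _] mE0 E0O.
pose D := [set F | lebesgue_measurable F /\ F `&` ~` Omega = E0].
(* [JfunE] asks for measurability, so the functional is replaced within the admissible class. *)
have JE F : D F -> Jfun s Omega F =
    nonlocal (@lebesgue_rV R n) (Jkernel R n s Omega) F.
  by move=> [mF _]; exact: JfunE.
rewrite (eq_imagel JE).
have [] := @nonlocal_minimizer _ _ _ (@lebesgue_rV R n) _
  (measurable_Jkernel _ _ s _ mO) (Jkernel_ge0 _ _ s Omega) D.
- by move=> F [].
- move=> A B [mA AE0] [mB BE0]; split; first exact: measurableU.
  by rewrite setIUl AE0 BE0 setUid.
- move=> A B [mA AE0] [mB BE0]; split; first exact: measurableI.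
  (* Doubling the complement of [Omega] gives each of [A] and [B] its own copy to be intersected
     with. *)
  by rewrite -{1}(setIid (~` Omega)) setIACA AE0 BE0 setIid.
- move=> F DF; split; first by apply: bigcupT_measurable => k; have [] := DF k.
  rewrite setI_bigcupl; under eq_bigcupr => k _ do rewrite (DF k).2.
  by rewrite bigcup_const//; exists 0%N.
- move=> F DF; split; first by apply: bigcapT_measurable => k; have [] := DF k.
  apply/seteqP; split=> x; first by move=> [Fx nO]; rewrite -(DF 0%N).2; split => //; exact: Fx.
  by move=> E0x; split; [move=> k _; move: E0x; rewrite -(DF k).2 => -[]|exact: E0O].
- by exists E0; split => //; exact: setIidl.
move=> E DE infE; have [mE EE0] := DE.
by exists E; split => //; rewrite JE.
Qed.
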